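(* Let $R$ be a commutative ring with unit. Suppose that $\phi\colon L_{2,R}\otimes_R L_{2,R}\to L_{2,R}$ is an injective, unital $*$-homomorphism of $R$-algebras. If $u,v\in\mathcal{U}(L_{2,R})$ have full spectrum, then $\phi(u\otimes 1)$ and $\phi(1\otimes v)$ cannot both be in $\mathcal{U}_V$.
   Context: $L_{2,R}$ denotes the universal unital $R$-algebra generated by elements $a,a^*,b,b^*$ subject to $a^*a=b^*b=1=aa^*+bb^*$. Let $\{a,b\}^*$ be the set of finite words in $a,b$ (including the empty word, interpreted as $1$); for $\alpha=\alpha_1\cdots\alpha_n$ put $\alpha^*=\alpha_n^*\cdots\alpha_1^*$. $L_{2,R}$ is spanned over $R$ by the elements $\alpha\beta^*$, and $\alpha\beta^*\mapsto\beta\alpha^*$ extends to an $R$-linear involution. $L_{2,R}\otimes_R L_{2,R}$ has involution $(x\otimes y)^*=x^*\otimes y^*$. A $*$-homomorphism is an $R$-algebra homomorphism preserving the involution. $\mathcal{U}(L_{2,R})=\{u: u^*u=uu^*=1\}$ is the unitary group. For $\alpha\in\{a,b\}^*$ let $Z(\alpha)=\{\alpha\xi:\xi\in\{a,b\}^{\mathbb{N}}\}$. The subgroup $\mathcal{U}_V\subseteq\mathcal{U}(L_{2,R})$ (the image of Thompson's group $V$) consists of all elements $\sum_{i=1}^n\alpha_i\beta_i^*$ with $\alpha_i,\beta_i\in\{a,b\}^*$ such that $\{a,b\}^{\mathbb{N}}=\bigsqcup_{i=1}^n Z(\alpha_i)=\bigsqcup_{i=1}^n Z(\beta_i)$ (disjoint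 unions). A unitary $u$ in a unital involutive $R$-algebra has full spectrum if $q(u)\neq 0$ for all nonzero polynomials $q\in R[x]$, where a constant term $c\in R$ is evaluated as $c\cdot 1$.
   Formalization: The commutative ring R is assumed nonzero (1 ≠ 0): over the zero ring the algebra is 0, every element trivially has full spectrum, and both images equal 1, which lies in U_V, so the claim fails there. *)

(* Defs.v *)
From HB Require Import structures.
From mathcomp Require Import all_boot all_algebra.
From mathcomp Require Import generic_quotient.
From mathcomp Require Import boolp classical_sets.

Set Implicit Arguments.
Unset Strict Implicit.
Unset Printing Implicit Defensive.

Import GRing.Theory.
Local Open Scope ring_scope.
Local Open Scope quotient_scope.

(* Throughout, the alphabet {a, b} is bool, with a = false and b = true. *)

(** * The algebra L_{2,R}, by generators and relations *)

Section Leavitt.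
Variable R : comNzRingType.

Inductive lterm : Type :=
| LGen of bool
| LGenS of bool
| LConst of R
| LAdd of lterm & lterm
| LMul of lterm & lterm.

(* The least congruence that contains the axioms of unital associative
   R-algebras (subtraction being addition of the multiple by -1) and the
   relations a^* a = b^* b = 1 = a a^* + b b^*. *)
Inductive leqv : lterm -> lterm -> Prop :=
| leqv_refl t : leqv t t
| leqv_sym t u : leqv t u -> leqv u t
| leqv_trans t u v : leqv t u -> leqv u v -> leqv t v
| leqv_add t t' u u' : leqv t t' -> leqv u u' -> leqv (LAdd t u) (LAdd t' u')
| leqv_mul t t' u u' : leqv t t' -> leqv u u' -> leqv (LMul t u) (LMul t' u')
| leqv_addA t u v : leqv (LAdd t (LAdd u v)) (LAdd (LAdd t u) v)
| leqv_addC t u : leqv (LAdd t u) (LAdd u t)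
| leqv_add0 t : leqv (LAdd (LConst 0) t) t
| leqv_mulA t u v : leqv (LMul t (LMul u v)) (LMul (LMul t u) v)
| leqv_mul1l t : leqv (LMul (LConst 1) t) t
| leqv_mul1r t : leqv (LMul t (LConst 1)) t
| leqv_mul0 t : leqv (LMul (LConst 0) t) (LConst 0)
| leqv_mulDl t u v : leqv (LMul (LAdd t u) v) (LAdd (LMul t v) (LMul u v))
| leqv_mulDr t u v : leqv (LMul t (LAdd u v)) (LAdd (LMul t u) (LMul t v))
| leqv_constD c d : leqv (LAdd (LConst c) (LConst d)) (LConst (c + d))
| leqv_constM c d : leqv (LMul (LConst c) (LConst d)) (LConst (c * d))
| leqv_constC c t : leqv (LMul (LConst c) t) (LMul t (LConst c))
| leqv_isom x : leqv (LMul (LGenS x) (LGen x)) (LConst 1)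
| leqv_sum : leqv (LAdd (LMul (LGen false) (LGenS false))
                        (LMul (LGen true) (LGenS true))) (LConst 1).

Definition leqvb (t u : {classic lterm}) : bool := `[< leqv t u >].

Fact leqvb_refl : reflexive leqvb.
Proof. by move=> t; apply/asboolP/leqv_refl. Qed.

Fact leqvb_sym : symmetric leqvb.
Proof. by move=> t u; apply/asboolP/asboolP; apply: leqv_sym. Qed.

Fact leqvb_trans : transitive leqvb.
Proof.
by move=> u t v /asboolP tu /asboolP uv; apply/asboolP/(leqv_trans tu uv).
Qed.

Canonical leqv_equiv := EquivRel leqvb leqvb_refl leqvb_sym leqvb_trans.

Definition L2 : Type := {eq_quot leqv_equiv}.
HB.instance Definition _ := Choice.on L2.

Definition lpi (t : lterm) : L2 := \pi_{eq_quot leqv_equiv} (t : {classic lterm}).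
Definition lrepr (x : L2) : lterm := repr (x : {eq_quot leqv_equiv}).

Lemma lreprK x : lpi (lrepr x) = x.
Proof. exact: (@reprK _ {eq_quot leqv_equiv}). Qed.

Lemma lpiP t u : lpi t = lpi u <-> leqv t u.
Proof.
split=> [/eqmodP/asboolP //|tu].
by apply/(@eqmodP _ leqv_equiv)/asboolP.
Qed.

Lemma lrepr_pi t : leqv (lrepr (lpi t)) t.
Proof. by apply/lpiP; rewrite lreprK. Qed.

Lemma lpi_ind (P : L2 -> Prop) : (forall t, P (lpi t)) -> forall x, P x.
Proof. by move=> Pp x; rewrite -(lreprK x). Qed.

Definition ladd (x y : L2) : L2 := lpi (LAdd (lrepr x) (lrepr y)).
Definition lmul (x y : L2) : L2 := lpi (LMul (lrepr x) (lrepr y)).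
Definition lscale (c : R) (x : L2) : L2 := lmul (lpi (LConst c)) x.
Definition lopp (x : L2) : L2 := lscale (- 1) x.

Lemma lpiD t u : ladd (lpi t) (lpi u) = lpi (LAdd t u).
Proof. by apply/lpiP/leqv_add; apply: lrepr_pi. Qed.

Lemma lpiM t u : lmul (lpi t) (lpi u) = lpi (LMul t u).
Proof. by apply/lpiP/leqv_mul; apply: lrepr_pi. Qed.

Fact laddA : associative ladd.
Proof.
elim/lpi_ind=> t; elim/lpi_ind=> u; elim/lpi_ind=> v.
by rewrite !lpiD; apply/lpiP/leqv_addA.
Qed.

Fact laddC : commutative ladd.
Proof.
by elim/lpi_ind=> t; elim/lpi_ind=> u; rewrite !lpiD; apply/lpiP/leqv_addC.
Qed.

Fact ladd0 : left_id (lpi (LConst 0)) ladd.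
Proof. by elim/lpi_ind=> t; rewrite lpiD; apply/lpiP/leqv_add0. Qed.

Fact lmulA : associative lmul.
Proof.
elim/lpi_ind=> t; elim/lpi_ind=> u; elim/lpi_ind=> v.
by rewrite !lpiM; apply/lpiP/leqv_mulA.
Qed.

Fact lmul1l : left_id (lpi (LConst 1)) lmul.
Proof. by elim/lpi_ind=> t; rewrite lpiM; apply/lpiP/leqv_mul1l. Qed.

Fact lmul1r : right_id (lpi (LConst 1)) lmul.
Proof. by elim/lpi_ind=> t; rewrite lpiM; apply/lpiP/leqv_mul1r. Qed.

Fact lmulDl : left_distributive lmul ladd.
Proof.
elim/lpi_ind=> t; elim/lpi_ind=> u; elim/lpi_ind=> v.
by rewrite !(lpiD, lpiM); apply/lpiP/leqv_mulDl.
Qed.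

Fact lmulDr : right_distributive lmul ladd.
Proof.
elim/lpi_ind=> t; elim/lpi_ind=> u; elim/lpi_ind=> v.
by rewrite !(lpiD, lpiM); apply/lpiP/leqv_mulDr.
Qed.

Fact lconstD c d : lpi (LConst (c + d)) = ladd (lpi (LConst c)) (lpi (LConst d)).
Proof. by rewrite lpiD; apply/lpiP/leqv_sym/leqv_constD. Qed.

Fact lconstM c d : lpi (LConst (c * d)) = lmul (lpi (LConst c)) (lpi (LConst d)).
Proof. by rewrite lpiM; apply/lpiP/leqv_sym/leqv_constM. Qed.

Fact lconstC c x : lmul (lpi (LConst c)) x = lmul x (lpi (LConst c)).
Proof. by elim/lpi_ind: x => t; rewrite !lpiM; apply/lpiP/leqv_constC. Qed.

Fact laddN : left_inverse (lpi (LConst 0)) lopp ladd.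
Proof.
move=> x; rewrite /lopp /lscale -{2}[x]lmul1l -lmulDl -lconstD addNr.
by elim/lpi_ind: x => t; rewrite lpiM; apply/lpiP/leqv_mul0.
Qed.

(* A representation of terms on R^nat (a and b act as the isometries onto the
   even and odd coordinates), giving 1 <> 0 in L_{2,R}. *)
Fixpoint lact (t : lterm) (f : nat -> R) : nat -> R :=
  match t with
  | LGen x => fun n => if odd n == x then f n./2 else 0
  | LGenS x => fun n => f (x + n.*2)%N
  | LConst c => fun n => c * f n
  | LAdd u v => fun n => lact u f n + lact v f n
  | LMul u v => lact u (lact v f)
  end.

Lemma lact_ext t f g : f =1 g -> lact t f =1 lact t g.
Proof.
elim: t f g => [x|x|c|u IHu v IHv|u IHu v IHv] f g fg n /=.
- by rewrite fg.
- by rewrite fg.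
- by rewrite fg.
- by rewrite (IHu f g) ?(IHv f g).
- by apply: IHu; apply: IHv.
Qed.

Lemma lactD t f g : lact t (fun n => f n + g n) =1 fun n => lact t f n + lact t g n.
Proof.
elim: t f g => [x|x|c|u IHu v IHv|u IHu v IHv] f g n //=.
- by case: ifP; rewrite ?addr0.
- by rewrite mulrDr.
- by rewrite IHu IHv addrACA.
- by rewrite (lact_ext _ (IHv f g)) IHu.
Qed.

Lemma lactZ t c f : lact t (fun n => c * f n) =1 fun n => c * lact t f n.
Proof.
elim: t f => [x|x|d|u IHu v IHv|u IHu v IHv] f n //=.
- by case: ifP; rewrite ?mulr0.
- by rewrite mulrCA.
- by rewrite IHu IHv mulrDr.
- by rewrite (lact_ext _ (IHv f)) IHu.
Qed.

Lemma lact_eqv t u : leqv t u -> forall f, lact t f =1 lact u f.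
Proof.
elim=> {t u}.
- by [].
- by move=> t u _ IH f n; rewrite IH.
- by move=> t u v _ IH _ IH' f n; rewrite IH IH'.
- by move=> t t' u u' _ IH _ IH' f n /=; rewrite IH IH'.
- by move=> t t' u u' _ IH _ IH' f n /=; rewrite IH; apply: lact_ext.
- by move=> t u v f n /=; rewrite addrA.
- by move=> t u f n /=; rewrite addrC.
- by move=> t f n /=; rewrite mul0r add0r.
- by [].
- by move=> t f n /=; rewrite mul1r.
- by move=> t f n /=; apply: lact_ext => m /=; rewrite mul1r.
- by move=> t f n /=; rewrite !mul0r.
- by [].
- by move=> t u v f n /=; rewrite lactD.
- by move=> c d f n /=; rewrite mulrDl.
- by move=> c d f n /=; rewrite mulrA.
- by move=> c t f n /=; rewrite lactZ.
- move=> x f n /=; rewrite oddD odd_double addbF oddb eqxx mul1r.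
  by rewrite half_bit_double.
- move=> f n /=; rewrite mul1r.
  by have := odd_double_half n; case: (odd n) => /= ->; rewrite ?addr0 ?add0r.
Qed.

Fact l2_1neq0 : lpi (LConst 1) != lpi (LConst 0).
Proof.
apply/eqP => /lpiP/lact_eqv /(_ (fun=> 1) 0%N) /= /eqP.
by rewrite mul0r mul1r (negPf (oner_neq0 R)).
Qed.

HB.instance Definition _ :=
  GRing.isZmodule.Build L2 laddA laddC ladd0 laddN.
HB.instance Definition _ :=
  GRing.Zmodule_isNzRing.Build L2 lmulA lmul1l lmul1r lmulDl lmulDr l2_1neq0.

Fact lscaleA c d (x : L2) : lscale c (lscale d x) = lscale (c * d) x.
Proof. by rewrite /lscale lmulA -lconstM. Qed.

Fact lscaleDr : right_distributive lscale +%R.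
Proof. by move=> c x y; apply: lmulDr. Qed.

Fact lscaleDl (x : L2) : {morph lscale^~ x : c d / c + d}.
Proof. by move=> c d; rewrite /lscale lconstD; apply: lmulDl. Qed.

HB.instance Definition _ :=
  GRing.Zmodule_isLmodule.Build R L2 lscaleA lmul1l lscaleDr lscaleDl.

Fact lscaleAl c (x y : L2) : c *: (x * y) = c *: x * y.
Proof. exact: lmulA. Qed.

HB.instance Definition _ := GRing.Lmodule_isLalgebra.Build R L2 lscaleAl.

Fact lscaleAr c (x y : L2) : c *: (x * y) = x * (c *: y).
Proof. by rewrite [LHS]lmulA lconstC [RHS]lmulA. Qed.

HB.instance Definition _ := GRing.Lalgebra_isAlgebra.Build R L2 lscaleAr.

Definition lgen (x : bool) : L2 := lpi (LGen x).
Definition lgenS (x : bool) : L2 := lpi (LGenS x).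

Lemma lpi_const c : lpi (LConst c) = c%:A.
Proof. by rewrite -[LHS]mulr1 [RHS]/(lmul _ _). Qed.

Lemma lpi_add t u : lpi (LAdd t u) = lpi t + lpi u.
Proof. by rewrite -lpiD. Qed.

Lemma lpi_mul t u : lpi (LMul t u) = lpi t * lpi u.
Proof. by rewrite -lpiM. Qed.

(** ** Universal property of L_{2,R} *)

Definition leavitt_family (A : algType R) (s s' : bool -> A) : Prop :=
  [/\ s' false * s false = 1, s' true * s true = 1
    & s false * s' false + s true * s' true = 1].

Lemma l2_family : leavitt_family lgen lgenS.
Proof.
split; rewrite -?lpi_mul -?lpi_add; apply/lpiP.
- exact: leqv_isom.
- exact: leqv_isom.
- exact: leqv_sum.
Qed.

Lemma l2_ind (P : L2 -> Prop) :
    (forall x, P (lgen x)) -> (forall x, P (lgenS x)) ->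
    (forall c, P c%:A) ->
    (forall x y, P x -> P y -> P (x + y)) ->
    (forall x y, P x -> P y -> P (x * y)) ->
  forall x, P x.
Proof.
move=> Pg PgS Pc PD PM; elim/lpi_ind; elim=> //.
- by move=> c; rewrite lpi_const.
- by move=> t Pt u Pu; rewrite lpi_add; apply: PD.
- by move=> t Pt u Pu; rewrite lpi_mul; apply: PM.
Qed.

Lemma l2_universal_uniq (A : algType R) (f g : {lrmorphism L2 -> A}) :
  f \o lgen =1 g \o lgen -> f \o lgenS =1 g \o lgenS -> f =1 g.
Proof.
move=> fg fgS; elim/l2_ind => //=.
- by move=> c; rewrite !rmorph_alg.
- by move=> x y fgx fgy; rewrite !rmorphD /= fgx fgy.
- by move=> x y fgx fgy; rewrite !rmorphM /= fgx fgy.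
Qed.

Section Eval.
Variables (A : algType R) (s s' : bool -> A).
Hypothesis rel_s : leavitt_family s s'.

Fixpoint leval (t : lterm) : A :=
  match t with
  | LGen x => s x
  | LGenS x => s' x
  | LConst c => c%:A
  | LAdd t u => leval t + leval u
  | LMul t u => leval t * leval u
  end.

Lemma leval_eqv t u : leqv t u -> leval t = leval u.
Proof.
case: rel_s => raa rbb rsum.
elim=> {t u} //=.
- by move=> t u v _ -> _ ->.
- by move=> t t' u u' _ -> _ ->.
- by move=> t t' u u' _ -> _ ->.
- by move=> t u v; rewrite addrA.
- by move=> t u; rewrite addrC.
- by move=> t; rewrite scale0r add0r.
- by move=> t u v; rewrite mulrA.
- by move=> t; rewrite scale1r mul1r.
- by move=> t; rewrite scale1r mulr1.
- by move=> t; rewrite scale0r mul0r.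
- by move=> t u v; rewrite mulrDl.
- by move=> t u v; rewrite mulrDr.
- by move=> c d; rewrite scalerDl.
- by move=> c d; rewrite mulr_algl scalerA.
- by move=> c t; rewrite mulr_algl mulr_algr.
- by case; rewrite scale1r.
- by rewrite scale1r.
Qed.

Definition lext (x : L2) : A := leval (lrepr x).

Lemma lext_pi t : lext (lpi t) = leval t.
Proof. by apply: leval_eqv; apply: lrepr_pi. Qed.

Lemma lext_linear : linear lext.
Proof.
move=> c; elim/lpi_ind=> t; elim/lpi_ind=> u.
rewrite -mulr_algl -lpi_const -lpi_mul -lpi_add !lext_pi /=.
by rewrite mulr_algl.
Qed.

Lemma lext_monoid : monoid_morphism lext.
Proof.
split; first by rewrite lext_pi /= scale1r.
by elim/lpi_ind=> t; elim/lpi_ind=> u; rewrite -lpi_mul !lext_pi.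
Qed.

HB.instance Definition _ := GRing.isLinear.Build R L2 A *:%R lext lext_linear.
HB.instance Definition _ := GRing.isMonoidMorphism.Build L2 A lext lext_monoid.

Lemma l2_universal :
  exists f : {lrmorphism L2 -> A}, f \o lgen =1 s /\ f \o lgenS =1 s'.
Proof. by exists lext; split=> x /=; rewrite lext_pi. Qed.

End Eval.

(** ** The involution *)

Fixpoint lstar (t : lterm) : lterm :=
  match t with
  | LGen x => LGenS x
  | LGenS x => LGen x
  | LConst c => LConst c
  | LAdd t u => LAdd (lstar t) (lstar u)
  | LMul t u => LMul (lstar u) (lstar t)
  end.

Lemma lstar_eqv t u : leqv t u -> leqv (lstar t) (lstar u).
Proof.
elim=> {t u} /=; try by constructor.
- by move=> t u v _ IH _ IH'; apply: leqv_trans IH'.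
- by move=> t u v; apply/leqv_sym/leqv_mulA.
- by move=> t; apply: leqv_trans (leqv_sym (leqv_constC _ _)) (leqv_mul0 _).
- by move=> c d; rewrite mulrC; apply: leqv_constM.
- by move=> c t; apply/leqv_sym/leqv_constC.
Qed.

Definition star (x : L2) : L2 := lpi (lstar (lrepr x)).

Lemma star_pi t : star (lpi t) = lpi (lstar t).
Proof. by apply/lpiP/lstar_eqv/lrepr_pi. Qed.

Lemma star_lgen x : star (lgen x) = lgenS x.
Proof. exact: star_pi. Qed.

Lemma star_lgenS x : star (lgenS x) = lgen x.
Proof. exact: star_pi. Qed.

Lemma starK : involutive star.
Proof.
elim/lpi_ind=> t; rewrite !star_pi; congr lpi.
by elim: t => //= [t -> u ->|t -> u ->].
Qed.

Lemma starM x y : star (x * y) = star y * star x.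
Proof.
elim/lpi_ind: x => t; elim/lpi_ind: y => u.
by rewrite -lpi_mul !star_pi lpi_mul.
Qed.

Lemma star1 : star 1 = 1.
Proof. exact: star_pi. Qed.

Fact star_linear : linear star.
Proof.
move=> c; elim/lpi_ind=> t; elim/lpi_ind=> u.
rewrite -mulr_algl -lpi_const -lpi_mul -lpi_add !star_pi /=.
by rewrite lpi_add lpi_mul lpi_const mulr_algr.
Qed.

HB.instance Definition _ := GRing.isLinear.Build R L2 L2 *:%R star star_linear.

(** ** Words *)

Definition word (w : seq bool) : L2 := \prod_(x <- w) lgen x.

Lemma star_word w : star (word w) = \prod_(x <- rev w) lgenS x.
Proof.
rewrite /word; elim: w => [|x w IH]; first by rewrite !big_nil star1.
by rewrite big_cons starM IH star_lgen rev_cons -cats1 big_cat big_seq1.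
Qed.

Lemma star_word_word u v :
  star (word u * star (word v)) = word v * star (word u).
Proof. by rewrite starM starK. Qed.

(** * The tensor product L_{2,R} (x) L_{2,R} over R *)

(* A formal sum of pairs (x, y) stands for the sum of the x (x) y.  Two formal
   sums are identified when every R-bilinear map takes the same value on
   them, i.e. when they differ by the bilinearity relations. *)
Implicit Types M : lmodType R.
Local Notation fsum := (seq (L2 * L2)).

Definition bilin (M : lmodType R) (f : L2 -> L2 -> M) : Prop :=
  bilinear_for *:%R *:%R f.

Definition fval (M : lmodType R) (f : L2 -> L2 -> M) (s : fsum) : M :=
  \sum_(p <- s) f p.1 p.2.

Definition teqv (s t : fsum) : Prop :=
  forall (M : lmodType R) (f : L2 -> L2 -> M), bilin f -> fval f s = fval f t.

Definition teqvb (s t : {classic fsum}) : bool := `[< teqv s t >].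

Fact teqvb_refl : reflexive teqvb.
Proof. by move=> s; apply/asboolP. Qed.

Fact teqvb_sym : symmetric teqvb.
Proof.
by move=> s t; apply/asboolP/asboolP => st M f fb; rewrite (st M f fb).
Qed.

Fact teqvb_trans : transitive teqvb.
Proof.
move=> t s u /asboolP st /asboolP tu; apply/asboolP => M f fb.
by rewrite (st M f fb) (tu M f fb).
Qed.

Canonical teqv_equiv := EquivRel teqvb teqvb_refl teqvb_sym teqvb_trans.

Definition L2L2 : Type := {eq_quot teqv_equiv}.
HB.instance Definition _ := Choice.on L2L2.

Definition tpi (s : fsum) : L2L2 := \pi_{eq_quot teqv_equiv} (s : {classic fsum}).
Definition trepr (x : L2L2) : fsum := repr (x : {eq_quot teqv_equiv}).

Definition tensor (x y : L2) : L2L2 := tpi [:: (x, y)].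

Lemma treprK x : tpi (trepr x) = x.
Proof. exact: (@reprK _ {eq_quot teqv_equiv}). Qed.

Lemma tpiP s t : tpi s = tpi t <-> teqv s t.
Proof.
split=> [/eqmodP/asboolP //|st].
by apply/(@eqmodP _ teqv_equiv)/asboolP.
Qed.

Lemma trepr_pi s : teqv (trepr (tpi s)) s.
Proof. by apply/tpiP; rewrite treprK. Qed.

Lemma tpi_ind (P : L2L2 -> Prop) : (forall s, P (tpi s)) -> forall x, P x.
Proof. by move=> Pp x; rewrite -(treprK x). Qed.

Lemma bilin_l M (f : L2 -> L2 -> M) y : bilin f -> linear (f^~ y).
Proof. by case=> + _; apply. Qed.

Lemma bilin_r M (f : L2 -> L2 -> M) x : bilin f -> linear (f x).
Proof. by case=> _; apply. Qed.

Lemma linear_Z (U V : lmodType R) (g : U -> V) : linear g ->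
  forall c x, g (c *: x) = c *: g x.
Proof. exact: scalable_linear. Qed.

Definition fscale (c : R) (s : fsum) : fsum := [seq (c *: p.1, p.2) | p <- s].
(* Inducing the product (x (x) y) (x' (x) y') = x x' (x) y y'. *)
Definition fmul (s t : fsum) : fsum :=
  [seq (p.1 * q.1, p.2 * q.2) | p <- s, q <- t].

Lemma fval_cat M (f : L2 -> L2 -> M) s t : fval f (s ++ t) = fval f s + fval f t.
Proof. exact: big_cat. Qed.

Lemma fval_scale M (f : L2 -> L2 -> M) c s : bilin f ->
  fval f (fscale c s) = c *: fval f s.
Proof.
move=> fb; rewrite /fval big_map scaler_sumr; apply: eq_bigr => p _ /=.
exact: (linear_Z (bilin_l p.2 fb)).
Qed.

Lemma fval_mul M (f : L2 -> L2 -> M) s t : fval f (fmul s t) =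
  \sum_(p <- s) \sum_(q <- t) f (p.1 * q.1) (p.2 * q.2).
Proof. exact: big_allpairs_dep. Qed.

Lemma bilin_mulr M (f : L2 -> L2 -> M) (t : fsum) : bilin f ->
  bilin (fun x y => \sum_(q <- t) f (x * q.1) (y * q.2)).
Proof.
move=> fb; split=> [y|x] c z1 z2.
  rewrite /= scaler_sumr -big_split; apply: eq_bigr => q _ /=.
  by rewrite mulrDl -scalerAl (bilin_l _ fb).
rewrite /= scaler_sumr -big_split; apply: eq_bigr => q _ /=.
by rewrite mulrDl -scalerAl (bilin_r _ fb).
Qed.

Lemma bilin_mull M (f : L2 -> L2 -> M) (t : fsum) : bilin f ->
  bilin (fun x y => \sum_(p <- t) f (p.1 * x) (p.2 * y)).
Proof.
move=> fb; split=> [y|x] c z1 z2.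
  rewrite /= scaler_sumr -big_split; apply: eq_bigr => q _ /=.
  by rewrite mulrDr -scalerAr (bilin_l _ fb).
rewrite /= scaler_sumr -big_split; apply: eq_bigr => q _ /=.
by rewrite mulrDr -scalerAr (bilin_r _ fb).
Qed.

Lemma teqv_mul s s' t t' : teqv s s' -> teqv t t' -> teqv (fmul s t) (fmul s' t').
Proof.
move=> ss' tt' M f fb; rewrite !fval_mul.
transitivity (fval (fun x y => \sum_(q <- t) f (x * q.1) (y * q.2)) s') => //.
  by rewrite -(ss' _ _ (bilin_mulr t fb)).
rewrite /fval exchange_big [RHS]exchange_big.
exact: (tt' _ _ (bilin_mull s' fb)).
Qed.

Definition tadd (x y : L2L2) : L2L2 := tpi (trepr x ++ trepr y).
Definition tscale (c : R) (x : L2L2) : L2L2 := tpi (fscale c (trepr x)).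
Definition topp (x : L2L2) : L2L2 := tscale (- 1) x.
Definition tmul (x y : L2L2) : L2L2 := tpi (fmul (trepr x) (trepr y)).

Lemma tpiD s t : tadd (tpi s) (tpi t) = tpi (s ++ t).
Proof. by apply/tpiP => M f fb; rewrite !fval_cat !(trepr_pi _ fb). Qed.

Lemma tpiZ c s : tscale c (tpi s) = tpi (fscale c s).
Proof. by apply/tpiP => M f fb; rewrite !fval_scale // (trepr_pi _ fb). Qed.

Lemma tpiM s t : tmul (tpi s) (tpi t) = tpi (fmul s t).
Proof. by apply/tpiP/teqv_mul; apply: trepr_pi. Qed.

Fact taddA : associative tadd.
Proof.
elim/tpi_ind=> s; elim/tpi_ind=> t; elim/tpi_ind=> u.
by rewrite !tpiD catA.
Qed.

Fact taddC : commutative tadd.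
Proof.
elim/tpi_ind=> s; elim/tpi_ind=> t; rewrite !tpiD.
by apply/tpiP => M f fb; rewrite !fval_cat addrC.
Qed.

Fact tadd0 : left_id (tpi [::]) tadd.
Proof. by elim/tpi_ind=> s; rewrite tpiD. Qed.

Fact taddN : left_inverse (tpi [::]) topp tadd.
Proof.
elim/tpi_ind=> s; rewrite /topp tpiZ tpiD; apply/tpiP => M f fb.
by rewrite fval_cat fval_scale // scaleN1r addNr /fval big_nil.
Qed.

HB.instance Definition _ := GRing.isZmodule.Build L2L2 taddA taddC tadd0 taddN.

Fact tscaleA c d (x : L2L2) : tscale c (tscale d x) = tscale (c * d) x.
Proof.
elim/tpi_ind: x => s; rewrite !tpiZ; apply/tpiP => M f fb.
by rewrite !fval_scale // scalerA.
Qed.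

Fact tscale1 : left_id 1 tscale.
Proof.
elim/tpi_ind=> s; rewrite tpiZ; apply/tpiP => M f fb.
by rewrite !fval_scale // scale1r.
Qed.

Fact tscaleDr : right_distributive tscale +%R.
Proof.
move=> c; elim/tpi_ind=> s; elim/tpi_ind=> t.
rewrite -[_ + tpi t]/(tadd _ _) -[RHS]/(tadd _ _) !(tpiD, tpiZ).
apply/tpiP => M f fb; rewrite fval_cat !fval_scale // fval_cat scalerDr //.
Qed.

Fact tscaleDl (x : L2L2) : {morph tscale^~ x : c d / c + d}.
Proof.
move=> c d; elim/tpi_ind: x => s.
rewrite -[RHS]/(tadd _ _) !tpiZ tpiD; apply/tpiP => M f fb.
by rewrite fval_cat !fval_scale // scalerDl.
Qed.

HB.instance Definition _ :=
  GRing.Zmodule_isLmodule.Build R L2L2 tscaleA tscale1 tscaleDr tscaleDl.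

Lemma tpi_cat s t : tpi (s ++ t) = tpi s + tpi t.
Proof. by rewrite -tpiD. Qed.

Lemma tpi_scale c s : tpi (fscale c s) = c *: tpi s.
Proof. by rewrite -tpiZ. Qed.

(** ** Universal property of the tensor product *)

Lemma tensor_bilinear : bilin tensor.
Proof.
by split=> [y|x] c z1 z2; rewrite /= /tensor -tpi_scale -tpi_cat;
  apply/tpiP => M f fb; rewrite /fval !big_cons !big_nil /= !addr0;
  rewrite ?(bilin_l _ fb) ?(bilin_r _ fb) ?(linear_Z (bilin_l _ fb)).
Qed.

Lemma tpi_sum s : tpi s = \sum_(p <- s) tensor p.1 p.2.
Proof.
elim: s => [|[x y] s IH]; first by rewrite big_nil.
by rewrite -cat1s tpi_cat IH big_cons.
Qed.

Lemma tensor_universal (M : lmodType R) (f : L2 -> L2 -> M) : bilin f ->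
  exists g : {linear L2L2 -> M}, forall x y, g (tensor x y) = f x y.
Proof.
move=> fb; pose g x := fval f (trepr x).
have gpi s : g (tpi s) = fval f s by apply: trepr_pi.
have glin : linear g.
  move=> c; elim/tpi_ind=> s; elim/tpi_ind=> t.
  by rewrite -tpi_scale -tpi_cat !gpi fval_cat fval_scale.
pose gL := GRing.isLinear.Build R L2L2 M *:%R g glin.
exists (HB.pack_for {linear L2L2 -> M} g gL) => x y /=.
by rewrite gpi /fval big_seq1.
Qed.

Lemma tensor_universal_uniq (M : lmodType R) (f g : {linear L2L2 -> M}) :
  (forall x y, f (tensor x y) = g (tensor x y)) -> f =1 g.
Proof.
move=> fg; elim/tpi_ind=> s; rewrite tpi_sum !linear_sum.
by apply: eq_bigr => p _; apply: fg.
Qed.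

(** ** The algebra structure *)

Fact tmulA : associative tmul.
Proof.
elim/tpi_ind=> s; elim/tpi_ind=> t; elim/tpi_ind=> u.
rewrite !tpiM; apply/tpiP => M f fb; rewrite !fval_mul /fmul.
rewrite big_allpairs_dep; apply: eq_bigr => p _ /=.
rewrite big_allpairs_dep; apply: eq_bigr => q _ /=.
by apply: eq_bigr => r _; rewrite !mulrA.
Qed.

Fact tmul1l : left_id (tensor 1 1) tmul.
Proof.
elim/tpi_ind=> s; rewrite tpiM; apply/tpiP => M f fb.
by rewrite fval_mul big_seq1; apply: eq_bigr => p _; rewrite !mul1r.
Qed.

Fact tmul1r : right_id (tensor 1 1) tmul.
Proof.
elim/tpi_ind=> s; rewrite tpiM; apply/tpiP => M f fb; rewrite fval_mul.
by apply: eq_bigr => p _; rewrite big_seq1 !mulr1.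
Qed.

Fact tmulDl : left_distributive tmul +%R.
Proof.
elim/tpi_ind=> s; elim/tpi_ind=> t; elim/tpi_ind=> u.
rewrite -tpi_cat !tpiM -tpi_cat; apply/tpiP => M f fb.
by rewrite fval_cat !fval_mul big_cat.
Qed.

Fact tmulDr : right_distributive tmul +%R.
Proof.
elim/tpi_ind=> s; elim/tpi_ind=> t; elim/tpi_ind=> u.
rewrite -tpi_cat !tpiM -tpi_cat; apply/tpiP => M f fb.
rewrite fval_cat !fval_mul -big_split; apply: eq_bigr => p _.
by rewrite big_cat.
Qed.

Definition lcoef (x : L2) : R := lact (lrepr x) (fun=> 1) 0%N.

Lemma lcoef_pi t : lcoef (lpi t) = lact t (fun=> 1) 0%N.
Proof. by apply: lact_eqv; apply: lrepr_pi. Qed.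

Lemma lcoefP c x y : lcoef (c *: x + y) = c * lcoef x + lcoef y.
Proof.
elim/lpi_ind: x => t; elim/lpi_ind: y => u.
by rewrite -mulr_algl -lpi_const -lpi_mul -lpi_add !lcoef_pi.
Qed.

Fact t_1neq0 : tensor 1 1 != 0.
Proof.
pose f x y : R^o := lcoef x * lcoef y.
have fb : bilin f.
  split=> [y|x] c z1 z2; rewrite /f /= lcoefP.
    by rewrite mulrDl -mulrA.
  by rewrite mulrDr mulrCA.
have [g gE] := tensor_universal fb; apply/eqP => /(congr1 g).
rewrite gE linear0 /f lcoef_pi /= !mulr1 => /eqP.
by rewrite (negPf (oner_neq0 R)).
Qed.

HB.instance Definition _ :=
  GRing.Zmodule_isNzRing.Build L2L2 tmulA tmul1l tmul1r tmulDl tmulDr t_1neq0.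

Lemma tpi_mul s t : tpi (fmul s t) = tpi s * tpi t.
Proof. by rewrite -tpiM. Qed.

Fact tscaleAl c (x y : L2L2) : c *: (x * y) = c *: x * y.
Proof.
elim/tpi_ind: x => s; elim/tpi_ind: y => t.
rewrite -tpi_mul -!tpi_scale -tpi_mul; apply/tpiP => M f fb.
rewrite fval_scale // !fval_mul big_map scaler_sumr; apply: eq_bigr => p _.
rewrite scaler_sumr; apply: eq_bigr => q _ /=.
by rewrite -scalerAl (linear_Z (bilin_l _ fb)).
Qed.

HB.instance Definition _ := GRing.Lmodule_isLalgebra.Build R L2L2 tscaleAl.

Fact tscaleAr c (x y : L2L2) : c *: (x * y) = x * (c *: y).
Proof.
elim/tpi_ind: x => s; elim/tpi_ind: y => t.
rewrite -tpi_mul -!tpi_scale -tpi_mul; apply/tpiP => M f fb.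
rewrite fval_scale // !fval_mul scaler_sumr; apply: eq_bigr => p _.
rewrite big_map scaler_sumr; apply: eq_bigr => q _ /=.
by rewrite -scalerAr (linear_Z (bilin_l _ fb)).
Qed.

HB.instance Definition _ := GRing.Lalgebra_isAlgebra.Build R L2L2 tscaleAr.

Lemma tensor11 : tensor 1 1 = 1.
Proof. by []. Qed.

Lemma tensorM x y x' y' : tensor x y * tensor x' y' = tensor (x * x') (y * y').
Proof. exact: tpiM. Qed.

(** ** The involution (x (x) y)^* = x^* (x) y^* *)

Definition fstar (s : fsum) : fsum := [seq (star p.1, star p.2) | p <- s].

Definition tstar (x : L2L2) : L2L2 := tpi (fstar (trepr x)).

Lemma tstar_pi s : tstar (tpi s) = tpi (fstar s).
Proof.
apply/tpiP => M f fb; rewrite /fval !big_map /=.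
suff hb : bilin (fun x y => f (star x) (star y)).
  exact: (trepr_pi _ hb).
split=> [y|x] c z1 z2; rewrite linearP.
  exact: (bilin_l _ fb).
exact: (bilin_r _ fb).
Qed.

Lemma tstar_tensor x y : tstar (tensor x y) = tensor (star x) (star y).
Proof. exact: tstar_pi. Qed.

Fact tstar_linear : linear tstar.
Proof.
move=> c; elim/tpi_ind=> s; elim/tpi_ind=> t.
rewrite -tpi_scale -tpi_cat !tstar_pi -tpi_scale -tpi_cat.
congr tpi; rewrite /fstar map_cat; congr (_ ++ _).
by rewrite /fscale -!map_comp; apply: eq_map => p /=; rewrite linearZ.
Qed.

HB.instance Definition _ :=
  GRing.isLinear.Build R L2L2 L2L2 *:%R tstar tstar_linear.

(** * Unitaries, full spectrum and the group U_V *)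

Definition unitary (u : L2) : Prop := star u * u = 1 /\ u * star u = 1.

(* horner_alg u q is q(u), a constant c being evaluated as c%:A = c *: 1. *)
Definition full_spectrum (u : L2) : Prop :=
  forall q : {poly R}, q != 0 -> horner_alg u q != 0.

End Leavitt.

(* The infinite word w xi. *)
Definition concat (w : seq bool) (xi : nat -> bool) : nat -> bool :=
  fun k => if (k < size w)%N then nth false w k else xi (k - size w)%N.

Local Open Scope classical_set_scope.

Definition cylinder (w : seq bool) : set (nat -> bool) := range (concat w).

Definition cylinder_partition (n : nat) (w : 'I_n -> seq bool) : Prop :=
  \bigcup_(i in [set: 'I_n]) cylinder (w i) = setT
  /\ trivIset [set: 'I_n] (fun i => cylinder (w i)).

Definition UV (R : comNzRingType) : set (L2 R) :=
  [set u | exists (n : nat) (alpha beta : 'I_n -> seq bool),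
     [/\ cylinder_partition alpha, cylinder_partition beta
       & u = (\sum_(i < n) word R (alpha i) * star (word R (beta i)))%R]].

(* Main.v *)
Require Import Defs.
From HB Require Import structures.
From mathcomp Require Import all_boot all_algebra.
From mathcomp Require Import boolp classical_sets.
From mathcomp Require Import zify.
Import GRing.Theory.
Local Open Scope ring_scope.

Set Implicit Arguments.
Unset Strict Implicit.
Unset Printing Implicit Defensive.

(* Full spectrum makes R[x, y] -> L_2 (x) L_2, x |-> u (x) 1, y |-> 1 (x) v,
   injective, since the matrix coefficients of a faithful representation of L_2
   separate its points.  On the other hand two commuting elements U, W of V
   satisfy a nonzero polynomial relation.  By compactness of the Cantor set it
   suffices to find one near each point x.  Running U on x as a pushdown
   automaton, the pigeonhole principle shows that the orbit of x enters a
   cylinder Z(th) on which some power U^n, n <> 0, acts as th z |-> th ep z.  If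
   ep is empty, then U^|n| = 1 there.  Otherwise th ep^oo is an attracting fixed
   point of U^n; as U^n has finitely many fixed points with nontrivial germ and
   W permutes them, a power of W fixes th ep^oo, and the germs of U^n and of this
   power at that point are powers of a common translation.  This gives a relation
   W^A U^B = U^C with A > 0 on Z(th).  The polynomials y^A x^B - x^C and x^n - 1
   so obtained have a leading coefficient in y which is monic in x, and so do
   their products, hence these are nonzero over any R. *)

(** * Pigeonhole and compactness principles *)

Lemma infinite_pigeonhole (T : finType) (P : nat -> Prop) (g : nat -> T) :
    (forall n, exists2 m, (n <= m)%N & P m) ->
  exists i j, [/\ (i < j)%N, P i, P j & g i = g j].
Proof.
move=> inf.
have {inf} [next next_ge Pnext] : exists2 next,
    (forall n, (n <= next n)%N) & (forall n, P (next n)).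
  have /choice[f fP] : forall n, exists m, (n <= m)%N /\ P m.
    by move=> n; have [m] := inf n; exists m.
  by exists f => n; have [] := fP n.
pose e := fix e k := if k is k'.+1 then next (e k').+1 else next 0%N.
have Pe k : P (e k) by case: k => [|k] /=; apply: Pnext.
have e_lt i j : (i < j)%N -> (e i < e j)%N.
  elim: j => // j IH; rewrite ltnS leq_eqVlt => /predU1P[->|/IH eij].
    exact: next_ge.
  exact/(ltn_trans eij)/next_ge.
have /injectivePn[i [j neq_ij gij]] :
    ~~ injectiveb (fun i : 'I_#|T|.+1 => g (e i)).
  by apply/injectiveP => /leq_card; rewrite card_ord ltnn.
have [lt_ij|lt_ji|/val_inj eq_ij] := ltngtP i j.
- by exists (e i), (e j); split=> //; apply: e_lt.
- by exists (e j), (e i); split=> //; apply: e_lt.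
- by rewrite eq_ij eqxx in neq_ij.
Qed.

(** If [P] failed at the root, descending each time to a child where it fails would give a branch
    none of whose prefixes satisfies [P]. *)
Lemma binary_tree_compactness (P : seq bool -> Prop) :
    (forall w, P (rcons w false) -> P (rcons w true) -> P w) ->
    (forall x : nat -> bool, exists k, P (mkseq x k)) ->
  P [::].
Proof.
move=> Pnode Pbranch; apply: contrapT => nP0.
pose d w := `[< P (rcons w false) >].
pose go n := iter n (fun w => rcons w (d w)) [::].
have go_branch n : mkseq (fun k => d (go k)) n = go n.
  by elim: n => // n IH; rewrite mkseqS IH.
have [k] := Pbranch (fun k => d (go k)); rewrite {}go_branch.
elim: k => //= k IH; rewrite {1}/d; case: asboolP => // Pf Pt.
exact/IH/Pnode.
Qed.

(** * Combinatorics of words *)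

Section Words.
Variable T : eqType.
Implicit Types u v w c : seq T.

Definition wpow u n := iter n (cat u) [::].

Lemma wpowD u m n : wpow u (m + n) = wpow u m ++ wpow u n.
Proof. by elim: m => //= m IH; rewrite IH catA. Qed.

Lemma wpowSr u n : wpow u n.+1 = wpow u n ++ u.
Proof. by rewrite -addn1 wpowD /= cats0. Qed.

Lemma size_wpow u n : size (wpow u n) = (n * size u)%N.
Proof. by elim: n => //= n IH; rewrite size_cat IH mulSn. Qed.

Lemma wpow_comm u v n : u ++ v = v ++ u -> wpow u n ++ v = v ++ wpow u n.
Proof.
move=> uv; elim: n => [|n IH]; first by rewrite cats0.
by rewrite [wpow _ _]/= -catA IH !catA uv.
Qed.

(** The two powers commute and have the same length, so they are equal. *)
Lemma wpow_size u v : u ++ v = v ++ u -> wpow u (size v) = wpow v (size u).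
Proof.
move=> uv; have /eqP : wpow u (size v) ++ wpow v (size u) =
    wpow v (size u) ++ wpow u (size v).
  by apply: wpow_comm; apply/esym/wpow_comm.
by rewrite eqseq_cat ?size_wpow 1?mulnC // => /andP[/eqP].
Qed.

Lemma cat_split u v u' v' : u ++ v = u' ++ v' -> (size u <= size u')%N ->
  exists2 g, u' = u ++ g & v = g ++ v'.
Proof.
move=> eq_uv le_uu'; have Eu' : u' = u ++ drop (size u) u'.
  have := congr1 (take (size u)) eq_uv.
  by rewrite take_size_cat // takel_cat // => uE; rewrite {1}uE cat_take_drop.
exists (drop (size u) u') => //; apply/eqP; move: eq_uv.
by rewrite {1}Eu' -catA => /eqP; rewrite eqseq_cat // eqxx.
Qed.

Lemma conj_wpow a b u n : a ++ u = u ++ b -> wpow a n ++ u = u ++ wpow b n.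
Proof.
move=> au; elim: n => [|n IH]; first by rewrite cats0.
by rewrite [wpow a _]/= -catA IH !catA au.
Qed.

(* Both words are prefixes of the infinite word a a a ... *)
Lemma conj_prefix a b u v : a ++ u = u ++ b -> a ++ v = v ++ b ->
  (size u <= size v)%N -> (0 < size a)%N ->
  exists2 g, v = u ++ g & g ++ b = b ++ g.
Proof.
move=> au av le_uv a_gt0.
have le_v : (size v <= size (wpow a (size v)))%N.
  by rewrite size_wpow leq_pmulr.
have [g1 Eg1 _] := cat_split (esym (conj_wpow (size v) av)) le_v.
have [g2 Eg2 _] := cat_split (esym (conj_wpow (size v) au)) (leq_trans le_uv le_v).
have [g vE _] : exists2 g, v = u ++ g & g2 = g ++ g1.
  by apply: cat_split le_uv; rewrite -Eg1 -Eg2.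
exists g => //; apply/eqP; have := av.
rewrite {1 2}vE catA au -!catA => /eqP.
by rewrite eqseq_cat // eqxx eq_sym.
Qed.

End Words.

(** * Words in the Leavitt algebra *)

Section LeavittWords.
Variable R : comNzRingType.
Implicit Types (U V W : L2 R) (u v w : seq bool) (x : nat -> bool).
Local Notation wd := (word R).

Lemma word_nil : wd [::] = 1. Proof. exact: big_nil. Qed.

Lemma word_cons b w : wd (b :: w) = lgen R b * wd w.
Proof. exact: big_cons. Qed.

Lemma word_cat u v : wd (u ++ v) = wd u * wd v.
Proof. exact: big_cat. Qed.

Lemma word_rcons w b : wd (rcons w b) = wd w * lgen R b.
Proof. by rewrite -cats1 word_cat word_cons word_nil mulr1. Qed.

Lemma lgen_sum : \sum_b lgen R b * lgenS R b = 1.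
Proof. by have [_ _ <-] := l2_family R; rewrite big_bool addrC. Qed.

Lemma lgenS_lgen b c : lgenS R b * lgen R c = (b == c)%:R.
Proof.
have [aa bb sum1] := l2_family R.
have diag d : lgenS R d * lgen R d = 1 by case: d.
case: eqVneq => [->|neq_bc]; first exact: diag.
(* Inserting [lgen_sum] between the two factors doubles the product, which is therefore 0. *)
apply: (@addrI _ (lgenS R b * lgen R c)); rewrite addr0.
rewrite -{3}[lgenS R b]mulr1 -lgen_sum big_bool mulrDr mulrDl !mulrA.
by case: b c neq_bc => [] [] // _; rewrite !diag !mul1r -!mulrA !diag !mulr1.
Qed.

Lemma star_word_cons b w : star (wd (b :: w)) = star (wd w) * lgenS R b.
Proof. by rewrite word_cons starM star_lgen. Qed.

Lemma word_isom w : star (wd w) * wd w = 1.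
Proof.
elim: w => [|b w IH]; first by rewrite word_nil star1 mulr1.
rewrite star_word_cons word_cons mulrA -[_ * _ * lgen R b]mulrA lgenS_lgen.
by rewrite eqxx mulr1.
Qed.

Lemma word_orth u v : ~~ prefix u v -> ~~ prefix v u -> star (wd u) * wd v = 0.
Proof.
elim: u v => [|b u IH] [|c v] //; rewrite !prefix_cons.
rewrite star_word_cons word_cons mulrA -[_ * _ * lgen R c]mulrA lgenS_lgen.
rewrite [c == b]eq_sym; case: eqP => _ /= nuv nvu.
  by rewrite mulr1 IH.
by rewrite mulr0 mul0r.
Qed.

Lemma word_neq0 w : wd w != 0.
Proof.
apply/eqP => w0; have := word_isom w.
by rewrite w0 mulr0 => /esym/eqP; rewrite oner_eq0.
Qed.

Lemma word_mulI w : injective ( *%R (wd w)).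
Proof.
by move=> y z /(congr1 ( *%R (star (wd w)))); rewrite !mulrA word_isom !mul1r.
Qed.

Lemma word_inj : injective wd.
Proof.
have nil_cons b w : wd [::] <> wd (b :: w).
  (* Compressing by the letter other than [b] sends one side to 1 and the other to 0. *)
  rewrite word_nil word_cons => /(congr1 (fun z => lgenS R (~~ b) * z * lgen R (~~ b))).
  rewrite mulr1 mulrA !lgenS_lgen eqxx; case: b => /=;
  by rewrite !mul0r => /eqP; rewrite oner_eq0.
elim=> [|b u IH] [|c v] //; [by move/nil_cons | by move/esym/nil_cons |].
rewrite !word_cons => /(congr1 ( *%R (lgenS R b))); rewrite !mulrA !lgenS_lgen eqxx.
case: eqP => [-> |_]; first by rewrite !mul1r => /IH ->.
by rewrite mul1r mul0r => /eqP; rewrite (negPf (word_neq0 u)).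
Qed.

Lemma sum_word n : \sum_(t : n.-tuple bool) wd t * star (wd t) = 1.
Proof.
elim: n => [|n IH].
  rewrite (eq_bigr (fun=> 1)) => [|t _]; last by rewrite tuple0 word_nil star1 mulr1.
  by rewrite sumr_const card_tuple expn0.
rewrite (reindex (fun p : bool * n.-tuple bool => [tuple of p.1 :: p.2])) /=; last first.
  exists (fun t => (thead t, [tuple of behead t])) => [[b t] _|t _].
    by congr pair; apply: val_inj.
  by rewrite -tuple_eta.
rewrite -(pair_bigA _ (fun b (t : n.-tuple bool) => wd (b :: t) * star (wd (b :: t)))) /=.
rewrite -lgen_sum; apply: eq_bigr => b _.
rewrite -[lgen R b in RHS]mulr1 -IH mulr_sumr mulr_suml; apply: eq_bigr => t _.
by rewrite star_word_cons word_cons !mulrA.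
Qed.

(** * Prefix replacement maps *)

(** This keeps only the action of an element of V on deep cylinders, in a form stable under
    products; the depth [L] may grow. *)
Definition prefix_map U := exists L, forall w, size w = L -> exists v, U * wd w = wd v.

Lemma prefix_map_ge U : prefix_map U ->
  exists L, forall w, (L <= size w)%N -> exists v, U * wd w = wd v.
Proof.
case=> L UL; exists L => w le_w.
have [v Uv] := UL (take L w) (size_takel le_w).
by exists (v ++ drop L w); rewrite -{1}(cat_take_drop L w) !word_cat mulrA Uv.
Qed.

Lemma prefix_map1 : prefix_map 1.
Proof. by exists 0%N => w _; exists w; rewrite mul1r. Qed.

Lemma prefix_mapM U V : prefix_map U -> prefix_map V -> prefix_map (U * V).
Proof.
case/prefix_map_ge => L UL [M VM]; exists (M + L)%N => w sw.
have [v Vv] : exists v, V * wd (take M w) = wd v.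
  by apply/VM/size_takel; rewrite sw leq_addr.
have [|v' Uv'] := UL (v ++ drop M w).
  by rewrite size_cat size_drop sw addKn leq_addl.
exists v'; rewrite -Uv' word_cat -Vv -{1}(cat_take_drop M w) word_cat.
by rewrite !mulrA.
Qed.

Lemma prefix_mapX U n : prefix_map U -> prefix_map (U ^+ n).
Proof.
move=> PU; elim: n => [|n IH]; first exact: prefix_map1.
by rewrite exprS; apply: prefix_mapM.
Qed.

Lemma concat_mkseq w x : mkseq (concat w x) (size w) = w.
Proof.
apply: (@eq_from_nth _ false) => [|i]; rewrite size_mkseq // => ltiw.
by rewrite nth_mkseq // /concat ltiw.
Qed.

Lemma concat_cat u v x : concat (u ++ v) x = concat u (concat v x).
Proof.
apply/funext => k; rewrite /concat size_cat nth_cat.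
by case: (ltnP k (size u)) => ?; [rewrite ltn_addr|rewrite ltn_subLR // subnDA].
Qed.

Lemma UV_prefix_map U : UV U -> prefix_map U.
Proof.
case=> n [al [be [_ [be_cover be_disj] ->]]].
exists (\max_i size (be i)) => w sw.
(* Prolonged by any tail, [w] lies in some cylinder of the partition, whose [be i] is not longer
   than [w] and hence a prefix of it. *)
have : [set: nat -> bool]%classic (concat w (fun=> false)) by [].
rewrite -be_cover => -[i _ [x _ Ex]].
have le_i : (size (be i) <= size w)%N by rewrite sw leq_bigmax.
have /prefixP[c Ew] : prefix (be i) w.
  rewrite prefixE; apply/eqP; rewrite -{1}(concat_mkseq w (fun=> false)) -Ex.
  rewrite -[RHS](concat_mkseq (be i) x) /mkseq -map_take take_iota.
  by rewrite (minn_idPl le_i).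
exists (al i ++ c); rewrite Ew (bigD1 i) //= mulrDl mulr_suml.
rewrite [X in _ + X]big1 ?addr0 => [|j neq_ji].
  by rewrite !word_cat -!mulrA [_ * (wd (be i) * _)]mulrA word_isom mul1r.
have pfx k l : prefix (be k) (be l) -> k = l.
  case/prefixP=> d Ed; apply: be_disj => //; exists (concat (be l) (fun=> false)); split.
    by rewrite Ed concat_cat; exists (concat d (fun=> false)).
  by exists (fun=> false).
have [comp|incomp] := boolP (prefix (be j) (be i) || prefix (be i) (be j)).
  by case/orP: comp neq_ji => /pfx ->; rewrite eqxx.
have {incomp} [nji nij] := norP incomp.
by rewrite word_cat -mulrA [X in _ * X]mulrA word_orth // mul0r mulr0.
Qed.

Lemma UV_star U : UV U -> UV (star U).
Proof.
case=> n [al [be [pal pbe ->]]]; exists n, be, al; split=> //.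
by rewrite linear_sum; apply: eq_bigr => i _; exact: star_word_word.
Qed.

(* The pair (U, x) is run as a pushdown automaton: its stack s satisfies
   U^m (x_0 ... x_(k-1)) = s, where m is the number of applications of U and k
   the number of letters of x read so far.  A letter of x is read only when the
   stack is too short for U to be applied. *)
Lemma orbit_self_similar U x : prefix_map U -> exists m k n th de ep,
  [/\ (0 < n)%N, U ^+ m * wd (mkseq x k) = wd (th ++ de) &
      U ^+ n * wd th = wd (th ++ ep) \/ U ^+ n * wd (th ++ ep) = wd th].
Proof.
case=> L UL; have {UL} /choice[F FP] : forall w, exists v,
    size w = L -> U * wd w = wd v.
  move=> w; have [/UL[v Uv]|neq] := eqVneq (size w) L; first by exists v.
  by exists [::] => /eqP; rewrite (negPf neq).
pose step c := let: (m, k, s) := c in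
  if (size s < L)%N then (m, k.+1, rcons s (x k))
  else (m.+1, k, F (take L s) ++ drop L s).
pose c t := iter t step (0%N, 0%N, [::]).
pose m t := (c t).1.1; pose k t := (c t).1.2; pose s t := (c t).2.
have cS t : c t.+1 = step (c t) by [].
have read t : (size (s t) < L)%N ->
    [/\ m t.+1 = m t, k t.+1 = (k t).+1 & s t.+1 = rcons (s t) (x (k t))].
  by rewrite /m /k /s cS /step; case: (c t) => [[? ?] ?] /= ->.
have app t : (L <= size (s t))%N ->
    [/\ m t.+1 = (m t).+1, k t.+1 = k t &
        s t.+1 = F (take L (s t)) ++ drop L (s t)].
  by rewrite /m /k /s cS /step; case: (c t) => [[? ?] ?] /=; case: ltnP.
have run t : U ^+ m t * wd (mkseq x (k t)) = wd (s t).
  elim: t => [|t IH]; first by rewrite expr0 mul1r.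
  have [/read[-> -> ->]|le_L] := ltnP (size (s t)) L.
    by rewrite mkseqS !word_rcons mulrA IH.
  have [-> -> ->] := app _ le_L; rewrite exprS -mulrA IH.
  by rewrite -{1}(cat_take_drop L (s t)) !word_cat mulrA FP ?size_takel.
have mono t t' : (t <= t')%N -> (m t <= m t')%N /\ (k t <= k t')%N.
  elim: t' => [|t' IH]; first by rewrite leqn0 => /eqP ->.
  rewrite leq_eqVlt => /predU1P[-> //|/IH[lem lek]].
  by have [/read[-> -> _]|/app[-> -> _]] := ltnP (size (s t')) L; split; lia.
have takeP t : (size (take L (s t)) <= L)%N by rewrite size_take_min geq_minl.
pose g t := Bseq (takeP t).
have [inf_read|fin_read] :=
  pselect (forall t0, exists2 t, (t0 <= t)%N & (size (s t) < L)%N).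
  (* Here a whole stack, shorter than [L], recurs: the letters [ep] read in between are absorbed,
     which gives a contracting loop. *)
  have [i [j [lt_ij si sj /(congr1 val) /= gij]]] :=
    infinite_pigeonhole g inf_read.
  rewrite !take_oversize ?(ltnW si) ?(ltnW sj) // in gij.
  have [_ kS _] := read _ si.
  have [le_m le_k] := mono _ _ lt_ij.
  have [le_mi _] := mono _ _ (ltnW lt_ij).
  have xE : mkseq x (k j) = mkseq x (k i) ++ mkseq (fun d => x (k i + d)%N) (k j - k i).
    by rewrite /mkseq -{1}(subnKC (ltnW (leq_trans (eq_leq (esym kS)) le_k)))
       iotaD map_cat add0n -{2}[k i]addn0 iotaDl -map_comp.
  set ep := mkseq _ (k j - k i) in xE.
  have loop : U ^+ (m j - m i) * wd (s i ++ ep) = wd (s i).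
    by rewrite word_cat -{1}run -!mulrA -word_cat -xE mulrA -exprD subnK // run gij.
  exists (m i), (k i), (m j - m i)%N, (s i), [::], ep; split; last by right.
    rewrite lt0n; apply/negP => /eqP m0; move: loop; rewrite m0 expr0 mul1r.
    move=> /word_inj /(congr1 size); rewrite size_cat size_mkseq; lia.
  by rewrite cats0 run.
have [T T_app] : exists T, forall t, (T <= t)%N -> (L <= size (s t))%N.
  apply: contrapT => nT; apply: fin_read => T; apply: contrapT => nt.
  apply: nT; exists T => t le_t; rewrite leqNgt; apply/negP => st.
  by apply: nt; exists t.
(* After a minimal time the letters below the top [L] are never touched, so a recurring top [th]
   gives a loop from [th] to [th ++ ep]. *)
pose minimal t := (T <= t)%N /\ forall t', (t <= t')%N -> (size (s t) <= size (s t'))%N.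
have min_inf t0 : exists2 t, (t0 <= t)%N & minimal t.
  wlog le_T : t0 / (T <= t0)%N.
    case/(_ (maxn T t0)) => [|t]; rewrite ?leq_maxl // geq_max => /andP[_ le_t].
    by exists t.
  have [z] := ubnP (size (s t0)); elim: z => // z IH in t0 le_T *; rewrite ltnS => le_z.
  have [|nmin] := pselect (minimal t0); first by exists t0.
  have [t le_t lt_t] : exists2 t, (t0 <= t)%N & (size (s t) < size (s t0))%N.
    apply: contrapT => nt; apply: nmin; split=> // t le_t.
    by rewrite leqNgt; apply/negP => lt_t; apply: nt; exists t.
  have [||t1 le_t1 min_t1] := IH t; [exact: leq_trans le_t|exact: leq_trans le_z|].
  by exists t1 => //; apply: leq_trans le_t1.
have [i [j [lt_ij [le_Ti min_i] [le_Tj _] /(congr1 val) /= gij]]] :=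
  infinite_pigeonhole g min_inf.
have tail t : (i <= t)%N -> exists2 p, s t = p ++ drop L (s i) &
    U ^+ (t - i) * wd (take L (s i)) = wd p.
  elim: t => [|t IH].
    rewrite leqn0 => /eqP i0; rewrite -i0 subnn; exists (take L (s i)).
      by rewrite cat_take_drop.
    by rewrite expr0 mul1r.
  rewrite leq_eqVlt => /predU1P[<-|].
    exists (take L (s i)); first by rewrite cat_take_drop.
    by rewrite subnn expr0 mul1r.
  rewrite ltnS => le_it; have [p sE pE] := IH le_it.
  have Lp : (L <= size p)%N.
    have := min_i _ le_it; have := T_app _ le_Ti.
    rewrite sE size_cat size_drop; lia.
  exists (F (take L p) ++ drop L p).
    have [_ _ ->] := app _ (T_app _ (leq_trans le_Ti le_it)).
    rewrite sE takel_cat // drop_cat; case: ltngtP Lp => // [_|eqL] _.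
      by rewrite catA.
    by rewrite (@drop_oversize _ L p) ?eqL // subnn drop0 cats0.
  rewrite subSn // exprS -mulrA pE -{1}(cat_take_drop L p) !word_cat mulrA.
  by rewrite FP ?size_takel.
have [p sE pE] := tail _ (ltnW lt_ij).
exists (m i), (k i), (j - i)%N, (take L (s i)), (drop L (s i)), (drop L p).
split; [by rewrite subn_gt0|by rewrite cat_take_drop run|left].
have Lp : (L <= size p)%N.
  have := min_i _ (ltnW lt_ij); have := T_app _ le_Ti.
  rewrite sE size_cat size_drop; lia.
rewrite pE; congr wd; rewrite -{1}(cat_take_drop L p); congr (_ ++ _).
by rewrite gij sE takel_cat.
Qed.

End LeavittWords.

(** * Commuting prefix replacement maps *)

Section CommutingPrefixMaps.
Variable R : comNzRingType.
Implicit Types (U V W : L2 R) (u v w : seq bool) (x : nat -> bool).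
Local Notation wd := (word R).

Lemma dilation_pow V th ep k :
  V * wd th = wd (th ++ ep) -> V ^+ k * wd th = wd (th ++ wpow ep k).
Proof.
move=> Vth; elim: k => [|k IH]; first by rewrite expr0 mul1r cats0.
by rewrite exprS -mulrA IH word_cat mulrA Vth -word_cat -catA.
Qed.

(** Since [c] and [d] commute with [ep], their powers of exponent [size ep] are powers of [ep],
    which powers of [V] produce from [th] as well. *)
Lemma dilation_relation V W th ep c d D :
    V * wd th = wd (th ++ ep) -> W ^+ D * wd (th ++ c) = wd (th ++ d) ->
    c ++ ep = ep ++ c -> d ++ ep = ep ++ d -> c ++ d = d ++ c ->
  W ^+ (D * size ep) * V ^+ size c * wd th = V ^+ size d * wd th.
Proof.
move=> Vth Wth c_ep d_ep cd.
have Wpow r : W ^+ (D * r) * wd (th ++ wpow c r) = wd (th ++ wpow d r).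
  elim: r => [|r IH]; first by rewrite muln0 expr0 mul1r.
  rewrite mulnS addnC exprD -mulrA [wpow c _]/= catA word_cat [X in _ * X]mulrA Wth.
  rewrite -word_cat -catA -(wpow_comm _ cd) catA word_cat mulrA IH -word_cat.
  by rewrite -catA -wpowSr.
rewrite -mulrA !(dilation_pow _ Vth).
by rewrite -(wpow_size c_ep) -(wpow_size d_ep).
Qed.

(* W^i maps the attracting fixed point th ep^oo of V to c_i ep^oo, a fixed point
   of V at which V is not locally trivial.  Such a point is determined by the
   rule of the prefix replacement V that applies at it, so two of these points
   coincide: a power of W fixes th ep^oo, and the germs there of that power and
   of V are both translations along ep^oo. *)
Lemma commuting_dilation_relation V W W' th ep :
    prefix_map V -> prefix_map W -> V * W = W * V -> W' * W = 1 ->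
    (0 < size ep)%N -> V * wd th = wd (th ++ ep) ->
  exists A B C, (0 < A)%N /\ W ^+ A * V ^+ B * wd th = V ^+ C * wd th.
Proof.
move=> PV PW VW W'W ep_gt0 Vth; have [L VL] := PV.
have WI i : injective ( *%R (W ^+ i)).
  move=> y z; elim: i => [|i IH]; first by rewrite expr0 !mul1r.
  by rewrite exprS -!mulrA => /(congr1 ( *%R W')); rewrite !mulrA W'W !mul1r; apply: IH.
have /choice[kc kcP] : forall i, exists kc : nat * seq bool,
    W ^+ i * wd (th ++ wpow ep kc.1) = wd kc.2 /\ (L <= size kc.2)%N.
  move=> i; have [M WM] := prefix_map_ge (prefix_mapX i PW).
  have [|c0 Wc0] := WM (th ++ wpow ep M).
    by rewrite size_cat size_wpow (leq_trans (leq_pmulr M ep_gt0)) ?leq_addl.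
  (* [M] copies of [ep] make [W ^+ i] applicable; [L] more make the image long enough for [V]. *)
  exists ((M + L)%N, c0 ++ wpow ep L); split=> /=.
    by rewrite wpowD catA word_cat mulrA Wc0 -word_cat.
  by rewrite size_cat size_wpow (leq_trans (leq_pmulr L ep_gt0)) ?leq_addl.
pose k i := (kc i).1; pose c i := (kc i).2.
have Wc i : W ^+ i * wd (th ++ wpow ep (k i)) = wd (c i) by have [] := kcP i.
have c_ge i : (L <= size (c i))%N by have [] := kcP i.
have VWi i : V * W ^+ i = W ^+ i * V by apply: commrX.
have Vc i : V * wd (c i) = wd (c i ++ ep).
  have Vk : V * wd (th ++ wpow ep (k i)) = wd (th ++ wpow ep (k i)) * wd ep.
    rewrite -{1}(dilation_pow _ Vth) mulrA -exprS !(dilation_pow _ Vth).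
    by rewrite wpowSr catA word_cat.
  by rewrite word_cat -Wc mulrA VWi -mulrA Vk mulrA.
(* The rule of [V] that applies at [c i] determines the fixed point: it is [take L (c i)] followed
   by [eta] repeated forever. *)
have etaP i : exists eta, [/\ size eta = size ep,
    V * wd (take L (c i)) = wd (take L (c i) ++ eta) &
    eta ++ drop L (c i) = drop L (c i) ++ ep].
  have [d Vd] := VL _ (size_takel (c_ge i)).
  have /word_inj : wd (d ++ drop L (c i)) = wd (take L (c i) ++ (drop L (c i) ++ ep)).
    by rewrite word_cat -Vd -mulrA -word_cat cat_take_drop Vc catA cat_take_drop.
  move=> dE; have := congr1 size dE; rewrite !size_cat => sE.
  have [|eta dE' ceE] := cat_split (esym dE).
    by rewrite -(leq_add2r (size (drop L (c i)))) sE addnA leq_addr.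
  exists eta; split=> //; last by rewrite Vd dE'.
  by apply/eqP; move/eqP: sE; rewrite dE' size_cat -addnA eqn_add2l addnC eqn_add2l.
have takeP i : (size (take L (c i)) <= L)%N by rewrite size_take_min geq_minl.
have [i [j [lt_ij _ _ /(congr1 val) /= eq_take]]] :=
  infinite_pigeonhole (fun i => Bseq (takeP i))
    (fun n => ex_intro2 _ (fun=> True) n (leqnn n) I).
have [eta [s_eta Veta eta_i]] := etaP i.
have [eta' [_ Veta' eta_j]] := etaP j.
have {eta' Veta'} eta_j : eta ++ drop L (c j) = drop L (c j) ++ ep.
  move: Veta'; rewrite -eq_take Veta => /word_inj/eqP.
  by rewrite eqseq_cat // eqxx /= => /eqP ->.
have eta_gt0 : (0 < size eta)%N by rewrite s_eta.
have Wsplit y : W ^+ j * y = W ^+ i * (W ^+ (j - i) * y).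
  by rewrite mulrA -exprD subnKC // ltnW.
have ep_pow n : wpow ep n ++ ep = ep ++ wpow ep n by apply: wpow_comm.
have finish cc d : cc ++ ep = ep ++ cc -> d ++ ep = ep ++ d -> cc ++ d = d ++ cc ->
    W ^+ (j - i) * wd (th ++ cc) = wd (th ++ d) ->
    exists A B C, (0 < A)%N /\ W ^+ A * V ^+ B * wd th = V ^+ C * wd th.
  move=> c_ep d_ep cd Wcd.
  exists ((j - i) * size ep)%N, (size cc), (size d); split.
    by rewrite muln_gt0 subn_gt0 lt_ij.
  exact: dilation_relation Wcd c_ep d_ep cd.
case/orP: (leq_total (size (drop L (c i))) (size (drop L (c j)))) => le_size.
  have [g gE g_ep] := conj_prefix eta_i eta_j le_size eta_gt0.
  have cE : c j = c i ++ g.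
    by rewrite -(cat_take_drop L (c j)) gE -eq_take catA cat_take_drop.
  (* The witnesses come from [c j = c i ++ g] by cancelling [W ^+ i] on the left. *)
  apply: (finish (wpow ep (k j)) (wpow ep (k i) ++ g)) => //.
  - by rewrite -catA g_ep !catA ep_pow.
  - by rewrite catA -wpowD -catA -(wpow_comm _ (esym g_ep)) catA -wpowD addnC.
  - apply: (WI i); rewrite -Wsplit Wc cE catA word_cat [in RHS]word_cat.
    by rewrite mulrA Wc.
have [g gE g_ep] := conj_prefix eta_j eta_i le_size eta_gt0.
have cE : c i = c j ++ g.
  by rewrite -(cat_take_drop L (c i)) gE eq_take catA cat_take_drop.
apply: (finish (wpow ep (k j) ++ g) (wpow ep (k i))) => //.
- by rewrite -catA g_ep !catA ep_pow.
- by rewrite catA -wpowD -catA -(wpow_comm _ (esym g_ep)) catA -wpowD addnC.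
- apply: (WI i); rewrite -Wsplit Wc cE catA word_cat.
  by rewrite mulrA Wc -word_cat.
Qed.

(** * From local relations to a global polynomial relation *)

Lemma expr_mul_eq1 (A : nzRingType) (y z : A) n : y * z = 1 -> y ^+ n * z ^+ n = 1.
Proof.
move=> yz; elim: n => [|n IH]; first by rewrite mul1r.
by rewrite exprSr exprS mulrA -[_ * y * z]mulrA yz mulr1.
Qed.

Lemma UV_commuting_polynomial (E : {rmorphism {poly {poly R}} -> L2 R}) U W :
    E ('X%:P) = U -> E 'X = W -> UV U -> UV W -> unitary U -> unitary W ->
  exists2 P, lead_coef P \is monic & E P = 0.
Proof.
move=> E_U E_W UU UW [UsU UUs] [WsW _].
have PU := UV_prefix_map UU; have PUs := UV_prefix_map (UV_star UU).
have PW := UV_prefix_map UW.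
have commE P Q : E P * E Q = E Q * E P by rewrite -!rmorphM mulrC.
have EU n : E ('X^n)%:P = U ^+ n by rewrite !rmorphXn /= E_U.
have EW n : E 'X^n = W ^+ n by rewrite rmorphXn /= E_W.
suff [P Pmonic] : exists2 P, lead_coef P \is monic & E P * wd [::] = 0.
  by rewrite word_nil mulr1; exists P.
(* [E P * wd w = 0] says that the relation [P] holds on the cylinder of [w]; relations on its two
   halves are multiplied. *)
apply: (binary_tree_compactness (P := fun w =>
  exists2 P, lead_coef P \is monic & E P * wd w = 0)) => [w|x].
  case=> P Pm P0 [Q Qm Q0]; exists (P * Q).
    have PQm : lead_coef P * lead_coef Q \is monic by apply: rpredM.
    by rewrite lead_coef_proper_mul // monic_neq0.
  have split F b : E F * wd (rcons w b) = 0 -> E F * wd w * (lgen R b * lgenS R b) = 0.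
    by rewrite word_rcons !mulrA => ->; rewrite mul0r.
  rewrite -[LHS]mulr1 -lgen_sum big_bool mulrDr !split ?addr0 //.
    by rewrite rmorphM commE -mulrA P0 mulr0.
  by rewrite rmorphM -mulrA Q0 mulr0.
have [m [k [n [th [de [ep [n_gt0 orbit loop]]]]]]] := orbit_self_similar x PU.
suff [P Pm P0] : exists2 P, lead_coef P \is monic & E P * wd th = 0.
  (* [E P] commutes with the invertible [U ^+ m], so it may be tested on the image [th ++ de] of the
     prefix of [x]. *)
  exists k, P => //; rewrite -[LHS]mul1r -(expr_mul_eq1 m UsU) -mulrA [X in _ * X]mulrA.
  by rewrite -EU commE -mulrA EU orbit word_cat [E P * _]mulrA P0 mul0r mulr0.
have [ep0|ep_gt0] := posnP (size ep).
  have {}loop : U ^+ n * wd th = wd th.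
    by case: loop; rewrite (size0nil ep0) cats0.
  exists ('X^n - 1)%:P; first by rewrite lead_coefC monicXnsubC.
  by rewrite rmorphB rmorphB EU !rmorph1 mulrBl mul1r loop subrr.
have [A [B [C [A_gt0 rel]]]] : exists A B C,
    (0 < A)%N /\ W ^+ A * U ^+ B * wd th = U ^+ C * wd th.
  have comm_WU : U * W = W * U by rewrite -E_U -E_W commE.
  case: loop => [Uth|Uth].
    have comm : U ^+ n * W = W * U ^+ n by apply/esym/commrX/esym.
    have [A [B [C [A_gt0]]]] :=
      commuting_dilation_relation (prefix_mapX n PU) PW comm WsW ep_gt0 Uth.
    by rewrite -!exprM; exists A, (n * B)%N, (n * C)%N.
  have comm : star U ^+ n * W = W * star U ^+ n.
    apply/esym/commrX; rewrite /GRing.comm -[W in RHS]mulr1 -UUs.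
    by rewrite [W * (U * _)]mulrA -comm_WU !mulrA UsU mul1r.
  have Vth : star U ^+ n * wd th = wd (th ++ ep).
    by rewrite -Uth mulrA expr_mul_eq1 // mul1r.
  have [A [B [C [A_gt0]]]] :=
    commuting_dilation_relation (prefix_mapX n PUs) PW comm WsW ep_gt0 Vth.
  (* Multiplying by [U ^+ (n * B + n * C)] clears the inverses and thereby swaps the two
     exponents. *)
  rewrite -!exprM => rel; exists A, (n * C)%N, (n * B)%N; split=> //.
  have := congr1 ( *%R (U ^+ (n * B) * U ^+ (n * C))) rel.
  rewrite [X in _ = X -> _]mulrA -[X in _ = X * _ -> _]mulrA expr_mul_eq1 // mulr1 => <-.
  rewrite -[U ^+ (n * B) * _]exprD addnC exprD -!EU -EW.
  rewrite -!mulrA [E ('X^(n * B))%:P * _]mulrA (commE _ 'X^A) -mulrA.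
  rewrite [E ('X^(n * B))%:P * _]mulrA [in E ('X^(n * B))%:P * _]EU.
  rewrite expr_mul_eq1 // mul1r.
  by rewrite !mulrA (commE 'X^A).
have Bnz : ('X^B)%:P != 0 :> {poly {poly R}} by rewrite polyC_eq0 monic_neq0 ?monicXn.
exists (('X^B)%:P * 'X^A - ('X^C)%:P).
  (* As [A > 0], the subtracted term has lower degree in the outer variable, which leaves ['X^B] as
     leading coefficient. *)
  rewrite lead_coefDl ?lead_coef_Mmonic ?lead_coefC ?monicXn // size_polyN.
  by rewrite size_Mmonic ?monicXn // size_polyXn !size_polyC !monic_neq0 ?monicXn.
by rewrite rmorphB rmorphM commE !EU EW mulrBl rel subrr.
Qed.

End CommutingPrefixMaps.

(** * Linear functionals on the Leavitt algebra *)

Section MatrixCoefficients.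
Variable R : comNzRingType.
Implicit Types (x y : L2 R) (w : seq bool) (f : nat -> R).
Local Notation wd := (word R).

(** For [f = delta n] this is the matrix coefficient of [x] in row [m] and column [n]. *)
Definition lval f m x : R := lact (lrepr x) f m.

Lemma lval_pi f m (t : lterm R) : lval f m (lpi t) = lact t f m.
Proof. by apply: lact_eqv; apply: lrepr_pi. Qed.

Lemma lval_linear f m : linear (lval f m : L2 R -> R^o).
Proof.
move=> c; elim/lpi_ind=> t; elim/lpi_ind=> u.
by rewrite -mulr_algl -lpi_const -lpi_mul -lpi_add !lval_pi.
Qed.

HB.instance Definition _ f m :=
  GRing.isLinear.Build R (L2 R) R^o *:%R (lval f m) (lval_linear f m).

Lemma lval_sum f m (s : seq (R * seq bool)) :
  lval f m (\sum_(p <- s) p.1 *: wd p.2) = \sum_(p <- s) p.1 * lval f m (wd p.2).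
Proof.
elim: s => [|p s IH]; first by rewrite !big_nil linear0.
by rewrite !big_cons lval_linear IH.
Qed.

Lemma lval_mul f m x y : lval f m (x * y) = lval (fun k => lval f k y) m x.
Proof.
elim/lpi_ind: x => t; elim/lpi_ind: y => u.
rewrite -lpi_mul !lval_pi /=; apply: lact_ext => k; by rewrite lval_pi.
Qed.

Definition delta n : nat -> R := fun k => (k == n)%:R.

(* The binary digits of [code w n], least significant first, are w followed by
   those of n. *)
Definition code w n := foldr (fun (b : bool) k => b + k.*2)%N n w.

Lemma lval_word w n m : lval (delta n) m (wd w) = delta (code w n) m.
Proof.
elim: w m => [|b w IH] m; first by rewrite word_nil lval_pi /= mul1r.
rewrite word_cons lval_mul lval_pi /= IH /delta.
have [<-|neq] := eqVneq (odd m) b.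
  by rewrite -{2}(odd_double_half m) eqn_add2l -!muln2 eqn_pmul2r.
case: (m =P _) neq => // ->; rewrite oddD odd_double addbF.
by case: b; rewrite eqxx.
Qed.

Lemma lval_mul_word w n m x :
  lval (delta n) m (x * wd w) = lval (delta (code w n)) m x.
Proof. by rewrite lval_mul; apply: lact_ext => k; apply: lval_word. Qed.

(** The final 1 marks the end of the word; with 0 in its place, trailing letters [false] would be
    lost. *)
Lemma code_inj : injective (code^~ 1%N).
Proof.
have pos w : (0 < code w 1)%N by elim: w => //= b w; lia.
elim=> [|b u IH] [|c v] //=.
- by have := pos v; case: c; lia.
- by have := pos u; case: b; lia.
- move=> E; have Ebc : b = c.
    by have := congr1 odd E; rewrite !oddD !odd_double !addbF !oddb.
  congr cons => //; apply: IH; move: E; rewrite Ebc => /addnI.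
  exact: double_inj.
Qed.

(** * Separation of points by matrix coefficients *)

Definition word_span y :=
  exists s : seq (R * seq bool), y = \sum_(p <- s) p.1 *: wd p.2.

Lemma word_span_word w : word_span (wd w).
Proof. by exists [:: (1, w)]; rewrite big_seq1 scale1r. Qed.

Lemma word_span0 : word_span 0.
Proof. by exists [::]; rewrite big_nil. Qed.

Lemma word_spanD x y : word_span x -> word_span y -> word_span (x + y).
Proof. by move=> [s ->] [t ->]; exists (s ++ t); rewrite big_cat. Qed.

Lemma word_spanZ c x : word_span x -> word_span (c *: x).
Proof.
move=> [s ->]; exists [seq (c * p.1, p.2) | p <- s].
by rewrite big_map scaler_sumr; apply: eq_bigr => p _; rewrite scalerA.
Qed.

(** A long enough word on the right absorbs every adjoint generator in [x]. *)
Lemma word_span_mul x :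
  exists L, forall w, (L <= size w)%N -> word_span (x * wd w).
Proof.
elim/l2_ind: x => [b|b|c|x y [L xL] [M yM]|x y [L xL] [M yM]].
- by exists 0%N => w _; rewrite -word_cons; apply: word_span_word.
- exists 1%N => -[|c w] // _; rewrite word_cons mulrA lgenS_lgen.
  case: eqP => _; first by rewrite mul1r; apply: word_span_word.
  by rewrite mul0r; apply: word_span0.
- by exists 0%N => w _; rewrite mulr_algl; apply/word_spanZ/word_span_word.
- exists (maxn L M) => w; rewrite geq_max => /andP[Lw Mw].
  by rewrite mulrDl; apply: word_spanD; [apply: xL|apply: yM].
exists (M + L)%N => w le_w.
have [|s sE] := yM (take M w).
  by rewrite size_takel // (leq_trans (leq_addr _ _) le_w).
rewrite -(cat_take_drop M w) word_cat -mulrA [y * _]mulrA sE.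
rewrite mulr_suml mulr_sumr; elim: s {sE} => [|p s IH].
  by rewrite big_nil; apply: word_span0.
rewrite big_cons; apply: word_spanD IH; rewrite -scalerAl -scalerAr -word_cat.
apply/word_spanZ/xL; rewrite size_cat size_drop; lia.
Qed.

(** Distinct words send [delta 1] to distinct basis vectors, so once repeated words are collected
    each coefficient can be read off. *)
Lemma lval_span_eq0 y : word_span y ->
  (forall m, lval (delta 1) m y = 0) -> y = 0.
Proof.
move=> [s yE] y0.
have -> : y = \sum_(w <- undup [seq p.2 | p <- s])
    (\sum_(p <- s) p.1 * (w == p.2)%:R) *: wd w.
  rewrite yE; under [RHS]eq_bigr do rewrite scaler_suml.
  rewrite exchange_big /= big_seq [RHS]big_seq; apply: eq_bigr => p ps.
  rewrite (bigD1_seq p.2) ?undup_uniq ?mem_undup ?map_f //= eqxx mulr1.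
  rewrite big1 ?addr0 // => w /negPf ->; by rewrite mulr0 scale0r.
rewrite big1 // => w _; rewrite [X in X *: _](_ : _ = 0) ?scale0r //.
rewrite -[RHS](y0 (code w 1)) yE lval_sum; apply: eq_bigr => p _.
by rewrite lval_word /delta (inj_eq code_inj).
Qed.

(* This is the Cuntz-Krieger uniqueness theorem for the representation [lact]. *)
Lemma lval_eq0 x : (forall n m, lval (delta n) m x = 0) -> x = 0.
Proof.
move=> x0; have [L xL] := word_span_mul x.
(* Expanding 1 reduces the claim to the products [x * wd t], which lie in the span of the words. *)
rewrite -[x]mulr1 -(sum_word _ L) mulr_sumr big1 // => t _; rewrite mulrA.
rewrite (lval_span_eq0 (xL t _)) ?mul0r ?size_tuple // => m.
by rewrite lval_mul_word.
Qed.

End MatrixCoefficients.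

(** * Polynomials in u (x) 1 and 1 (x) v *)

Section TensorPolynomials.
Variables (R : comNzRingType) (u v : L2 R).

Lemma tensorZl c (x y : L2 R) : tensor (c *: x) y = c *: tensor x y.
Proof. exact: (linear_Z (bilin_l y (tensor_bilinear R))). Qed.

Lemma tensorDl (x x' y : L2 R) : tensor (x + x') y = tensor x y + tensor x' y.
Proof. by have := bilin_l y (tensor_bilinear R) 1 x x'; rewrite !scale1r. Qed.

Lemma tensor_exp1l (x : L2 R) n : tensor 1 x ^+ n = tensor 1 (x ^+ n).
Proof. by elim: n => // n IH; rewrite !exprS IH tensorM mulr1. Qed.

Lemma horner_alg_tensor (p : {poly R}) :
  horner_alg (tensor u 1) p = tensor (horner_alg u p) 1.
Proof.
elim/poly_ind: p => [|p c IH].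
  by rewrite !rmorph0 -(scale0r (0 : L2 R)) tensorZl scale0r.
rewrite !rmorphD !rmorphM /= !horner_algX !horner_algC IH tensorM mulr1.
by rewrite tensorDl tensorZl.
Qed.

Lemma tensor_commr : commr_rmorph (horner_alg (tensor u 1)) (tensor 1 v).
Proof.
by move=> p; rewrite /GRing.comm horner_alg_tensor !tensorM !mulr1 !mul1r.
Qed.

Definition tensor_eval := horner_morph tensor_commr.

HB.instance Definition _ := GRing.RMorphism.on tensor_eval.

Lemma tensor_evalE (P : {poly {poly R}}) :
  tensor_eval P = \sum_(i < size P) tensor (horner_alg u P`_i) (v ^+ i).
Proof.
rewrite /tensor_eval /horner_morph (horner_coef_wide _ (size_poly _ _)).
apply: eq_bigr => i _; rewrite coef_map /= horner_alg_tensor tensor_exp1l.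
by rewrite tensorM mulr1 mul1r.
Qed.

(** Applying a matrix coefficient [l] to the first tensor factor gives [q(v) = 0], where [q] has the
    coefficients [l] of [P_i(u)]. So [q = 0] for every [l], hence [P_i(u) = 0] and [P_i = 0]. *)
Lemma tensor_eval_inj (P : {poly {poly R}}) :
  full_spectrum u -> full_spectrum v -> tensor_eval P = 0 -> P = 0.
Proof.
move=> u_full v_full; rewrite tensor_evalE => P0; apply/polyP => i; rewrite coef0.
have [le_i|lt_i] := leqP (size P) i; first exact: nth_default.
have [->//|/u_full/eqP[]] := eqVneq P`_i 0.
apply: lval_eq0 => n m; pose l := lval (delta R n) m.
pose q := \poly_(j < size P) l (horner_alg u P`_j).
have fb : bilin (fun x y => l x *: y).
  split=> [y|x] c z1 z2 /=; last by rewrite scalerDr !scalerA mulrC.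
  have -> : l (c *: z1 + z2) = c * l z1 + l z2 by apply: lval_linear.
  by rewrite scalerDl scalerA.
have [g gE] := tensor_universal fb.
have q0 : horner_alg v q = 0.
  rewrite -[RHS](linear0 g) -P0 linear_sum /q poly_def rmorph_sum /=.
  by apply: eq_bigr => j _; rewrite gE linearZ rmorphXn /= horner_algX mulr_algl.
have [q_eq0|/v_full/eqP[]//] := eqVneq q 0.
have := coef_poly (size P) (fun j => l (horner_alg u P`_j)) i.
by rewrite -/q q_eq0 coef0 lt_i.
Qed.

End TensorPolynomials.

Theorem proposition5p3 (R : comNzRingType)
    (phi : {lrmorphism L2L2 R -> L2 R})
    (phi_inj : injective phi)
    (phi_star : forall t : L2L2 R, phi (tstar t) = star (phi t))
    (u v : L2 R)
    (u_unitary : unitary u) (v_unitary : unitary v)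
    (u_full : full_spectrum u) (v_full : full_spectrum v) :
  ~ (UV (phi (tensor u 1)) /\ UV (phi (tensor 1 v))).
Proof.
move=> [UVu UVv]; pose E := phi \o tensor_eval u v.
have Eu : E ('X%:P) = phi (tensor u 1).
  by rewrite /E /= /tensor_eval horner_morphC /= horner_algX.
have Ev : E 'X = phi (tensor 1 v) by rewrite /E /= /tensor_eval horner_morphX.
(* Unitarity passes through [phi], so the inverses of both images are their adjoints. *)
have UUu : unitary (phi (tensor u 1)).
  by rewrite /unitary -phi_star -!rmorphM tstar_tensor !tensorM star1 mulr1
    !u_unitary.1 !u_unitary.2 tensor11 rmorph1.
have UUv : unitary (phi (tensor 1 v)).
  by rewrite /unitary -phi_star -!rmorphM tstar_tensor !tensorM star1 mulr1
    !v_unitary.1 !v_unitary.2 tensor11 rmorph1.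
have [P Pmonic P0] := UV_commuting_polynomial Eu Ev UVu UVv UUu UUv.
have /(tensor_eval_inj u_full v_full) P_eq0 : tensor_eval u v P = 0.
  by apply: phi_inj; rewrite linear0.
by rewrite P_eq0 lead_coef0 monicE lead_coef0 eq_sym oner_eq0 in Pmonic.
Qed.
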